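(* Let $C$ be a bivariate copula and let $\phi=\phi(C)\in\left[-\frac12,1\right]$ be its Spearman's footrule. Then Blomqvist's beta $\beta(C)$ satisfies $$1-4\sqrt{\frac{1-\phi}{6}}\leqslant\beta(C)\leqslant\begin{cases}1, & \text{if } \frac14\leqslant\phi\leqslant1,\\ -1+4\sqrt{\dfrac{1+2\phi}{6}}, & \text{otherwise.}\end{cases}$$
   Context: A bivariate copula is a function $C:[0,1]^2\to[0,1]$ with $C(u,0)=C(0,v)=0$, $C(u,1)=u$, $C(1,v)=v$, that is 2-increasing. Blomqvist's beta: $\beta(C)=4C\left(\tfrac12,\tfrac12\right)-1$. Concordance function: for copulas $C_1,C_2$, $\mathcal{Q}(C_1,C_2)=4\int_{[0,1]^2}C_2(u,v)\,dC_1(u,v)-1$, where $dC_1$ denotes integration with respect to the probability measure on $[0,1]^2$ with distribution function $C_1$. Spearman's footrule: $\phi(C)=\tfrac12\left(3\mathcal{Q}(C,M)-1\right)$, where $M(u,v)=\min\{u,v\}$. *)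

(* Defs.v *)
From HB Require Import structures.
From mathcomp Require Import all_boot all_order all_algebra.
From mathcomp Require Import all_classical all_reals all_analysis.
Set Implicit Arguments.
Unset Strict Implicit.
Unset Printing Implicit Defensive.
Import Order.TTheory GRing.Theory Num.Theory.
Import numFieldNormedType.Exports.
Local Open Scope classical_set_scope.
Local Open Scope ring_scope.

(** A function [0,1]^2 -> [0,1] is represented by a function on the plane of
    which only the values on [0,1]^2 are ever constrained or used. *)
Record is_copula (R : realType) (C : R -> R -> R) : Prop := IsCopula {
  copula_range : forall u v : R,
    0 <= u <= 1 -> 0 <= v <= 1 -> 0 <= C u v <= 1 ;
  copula_u0 : forall u : R, 0 <= u <= 1 -> C u 0 = 0 ;
  copula_0v : forall v : R, 0 <= v <= 1 -> C 0 v = 0 ;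
  copula_u1 : forall u : R, 0 <= u <= 1 -> C u 1 = u ;
  copula_1v : forall v : R, 0 <= v <= 1 -> C 1 v = v ;
  copula_2incr : forall u1 u2 v1 v2 : R,
    0 <= u1 -> u1 <= u2 -> u2 <= 1 -> 0 <= v1 -> v1 <= v2 -> v2 <= 1 ->
    0 <= C u2 v2 - C u2 v1 - C u1 v2 + C u1 v1
}.

Notation plane R := (measurableTypeR R * measurableTypeR R)%type.

Definition unit_square (R : realType) : set (plane R) := `[0, 1] `*` `[0, 1].
Arguments unit_square R : clear implicits.

(** As C(1,1) = 1 for a copula, this forces P to be carried by [0,1]^2, and it
    determines P, since the rectangles [0,u] x [0,v] form a pi-system that
    generates the Borel sets of [0,1]^2. *)
Definition has_copula_df (R : realType) (C : R -> R -> R)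
    (P : probability (plane R) R) : Prop :=
  forall u v : R, 0 <= u <= 1 -> 0 <= v <= 1 ->
    P (`[0, u] `*` `[0, v]) = (C u v)%:E.

(** [get] returns an element of the set if there is one and an arbitrary
    default otherwise; for a copula [C] the set is a singleton. *)
Definition copula_measure (R : realType) (C : R -> R -> R) :
    probability (plane R) R :=
  get [set P | has_copula_df C P].

Definition concordance (R : realType) (C1 C2 : R -> R -> R) : R :=
  4 * (\int[copula_measure C1]_(p in unit_square R) C2 p.1 p.2) - 1.

Definition copulaM (R : realType) (u v : R) : R := Num.min u v.

Definition spearman_footrule (R : realType) (C : R -> R -> R) : R :=
  2^-1 * (3 * concordance C (@copulaM R) - 1).

Definition blomqvist_beta (R : realType) (C : R -> R -> R) : R :=
  4 * C (2^-1) (2^-1) - 1.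

(* Main.v *)
Require Import Defs.
From HB Require Import structures.
From mathcomp Require Import all_boot all_order all_algebra.
From mathcomp Require Import all_classical all_reals all_analysis.
From mathcomp Require Import measurable_realfun ring lra.
Set Implicit Arguments.
Unset Strict Implicit.
Unset Printing Implicit Defensive.
Import Order.TTheory GRing.Theory Num.Theory.
Import numFieldNormedType.Exports.
Local Open Scope classical_set_scope.
Local Open Scope ring_scope.

(** The probability measure of a copula [C] is built by quantile sampling.  For
    rational [q] the Lebesgue-Stieltjes measure of [u |-> C u q] is dominated by
    the uniform law, and its Radon-Nikodym density [f q] is a version of the
    conditional distribution function [P(V <= q | U = s)]; outside a null set it
    is nondecreasing in [q].  If [(s, t)] is uniform on the unit square, then
    [(s, inf {q | t <= f q s})] has distribution function [C].

    With [delta t = C t t], Fubini applied to the layers [min(x, y) > t] gives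
    [E min(U, V)] as the integral over [0,1] of [1 - 2t + delta t], and the
    footrule is [6 E min(U, V) - 2].  Since [delta] is nondecreasing, 2-Lipschitz
    and [0 <= delta t <= t], the value [d = delta (1/2)] confines [delta] between
    piecewise affine functions; integrating these yields
    [1/4 + d^2/2 <= E min(U, V) <= 1/2 - (1/2 - d)^2], which rearranges to
    the claim. *)

(** * Truncation of the line to the unit interval *)

Section clamp.
Context {R : realType}.
Implicit Types x y : R.

(** Precomposing with this retraction extends functions on [0,1] to the line while preserving
    monotonicity and Lipschitz bounds; it is also the uniform distribution function. *)
Definition clamp x : R := Num.max 0 (Num.min 1 x).

Lemma clamp_ge0 x : 0 <= clamp x.
Proof. by rewrite le_max lexx. Qed.

Lemma clamp_le1 x : clamp x <= 1.
Proof. by rewrite ge_max ler01 ge_min lexx. Qed.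

Lemma clamp01 x : 0 <= clamp x <= 1.
Proof. by rewrite clamp_ge0 clamp_le1. Qed.

Lemma clamp_id x : 0 <= x <= 1 -> clamp x = x.
Proof. by case/andP => x0 x1; rewrite /clamp min_r// max_r. Qed.

Lemma clamp_le0 x : x <= 0 -> clamp x = 0.
Proof. by move=> x0; rewrite /clamp max_l// ge_min x0 orbT. Qed.

Lemma clamp_ge1 x : 1 <= x -> clamp x = 1.
Proof. by move=> x0; rewrite /clamp min_l// max_r. Qed.

Lemma clamp_nd x y : x <= y -> clamp x <= clamp y.
Proof.
move=> xy; rewrite /clamp !maxEle !minEle.
by case: ifPn; case: ifPn; case: ifPn; case: ifPn; lra.
Qed.

Lemma clamp_lip x y : x <= y -> clamp y - clamp x <= y - x.
Proof.
move=> xy; rewrite /clamp !maxEle !minEle.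
by case: ifPn; case: ifPn; case: ifPn; case: ifPn; lra.
Qed.

End clamp.

Lemma lipschitz_cvg {R : realType} (f : R -> R) (k : R) (x : R) :
  (forall x y, x <= y -> 0 <= f y - f x <= k * (y - x)) -> f @ x --> f x.
Proof.
move=> fl; apply/cvgrPdist_le => e e0.
have k0 : 0 <= k.
  by have := fl 0 1 ler01; rewrite subr0 mulr1 => /andP[]; exact: le_trans.
near=> y.
have : `|x - y| <= e / (k + 1).
  by near: y; apply: cvgr_dist_le => //; rewrite divr_gt0// ltr_wpDl.
rewrite ler_pdivlMr ?ltr_wpDl// => h.
apply: le_trans h; case: (leP x y) => xy.
- have /andP[h1 h2] := fl _ _ xy.
  rewrite distrC ger0_norm// (le_trans h2)// distrC ger0_norm ?subr_ge0//.
  by rewrite mulrC ler_wpM2l ?subr_ge0// lerDl.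
- have /andP[h1 h2] := fl _ _ (ltW xy).
  rewrite ger0_norm// (le_trans h2)// ger0_norm ?subr_ge0 ?(ltW xy)//.
  by rewrite mulrC ler_wpM2l ?subr_ge0 ?(ltW xy)// lerDl.
Unshelve. all: end_near. Qed.

(** * Comparison and evaluation of Lebesgue-Stieltjes measures *)

Section stieltjes.
Context {R : realType}.
Local Open Scope ereal_scope.

(** Both sides are infima over the same countable covers by half-open intervals, and each cover is
    no more expensive for [F] than for [G]. No measurability of [A] enters. *)
Lemma le_lebesgue_stieltjes (F G : cumulative R R) :
  (forall x y, (x <= y)%R -> (F y - F x <= G y - G x)%R) ->
  forall A, lebesgue_stieltjes_measure F A <= lebesgue_stieltjes_measure G A.
Proof.
move=> FG A; apply: le_ereal_inf_tmp => _ [B [mB AB]] <-.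
apply: (@le_trans _ _ (\sum_(k <oo) wlength F (B k))).
  by apply: ereal_inf_lbound; exists B.
apply: lee_nneseries => [k _ _|k _]; first exact: wlength_ge0.
have : ocitv (B k) := mB k.
move=> [[a b] _ <-] /=.
have [ab|ba] := leP a b.
  by rewrite !wlength_itv_bnd//; apply: FG.
by rewrite set_itv_ge ?measure0//= bnd_simp -leNgt ltW.
Qed.

Lemma lebesgue_stieltjes_itv (F : cumulative R R) (a b : R) : (a <= b)%R ->
  lebesgue_stieltjes_measure F `]a, b]%classic = (F b - F a)%:E.
Proof.
move=> ab; rewrite /lebesgue_stieltjes_measure /measure_extension.
by rewrite measurable_mu_extE/= ?wlength_itv_bnd//; exact: is_ocitv.
Qed.

(** The closed interval lies between []a, b]] and []c, b]], which have equal mass because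
    [F c = F a]. *)
Lemma lebesgue_stieltjes_itvcc (F : cumulative R R) (c a b : R) :
  (c < a)%R -> (a <= b)%R -> F c = F a ->
  lebesgue_stieltjes_measure F `[a, b]%classic = (F b - F a)%:E.
Proof.
move=> ca ab Fca; apply/eqP; rewrite eq_le; apply/andP; split.
- rewrite -Fca -lebesgue_stieltjes_itv ?(le_trans (ltW ca))//.
  apply: le_measure; rewrite ?inE; try exact: measurable_itv.
  by apply: subset_itvr; rewrite bnd_simp.
- rewrite -lebesgue_stieltjes_itv//.
  apply: le_measure; rewrite ?inE; try exact: measurable_itv.
  exact: subset_itv_oc_cc.
Qed.

End stieltjes.

(** * The uniform law on the unit interval *)

Section clamp_cumulative.
Context {R : realType}.

Let clamp_ndh : nondecreasing (@clamp R).
Proof. exact: clamp_nd. Qed.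

Let clamp_rc : right_continuous (@clamp R).
Proof.
apply: right_continuousW => x; apply: (@lipschitz_cvg _ _ 1) => {}x y xy.
by rewrite subr_ge0 clamp_nd// mul1r clamp_lip.
Qed.

HB.instance Definition _ := isCumulative.Build R _ R (@clamp R) clamp_ndh clamp_rc.

Let clamp_cvgNy : @clamp R x @[x --> -oo] --> (0 : R).
Proof.
apply: cvg_near_cst; near=> x; rewrite clamp_le0//.
Unshelve. all: end_near. Qed.

Let clamp_cvgy : @clamp R x @[x --> +oo] --> (1 : R).
Proof.
apply: cvg_near_cst; near=> x; rewrite clamp_ge1//.
Unshelve. all: end_near. Qed.

HB.instance Definition _ :=
  isCumulativeBounded.Build R 0 1 (@clamp R) clamp_cvgNy clamp_cvgy.

Definition unif : probability (measurableTypeR R) R :=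
  lebesgue_stieltjes_measure (@clamp R).

End clamp_cumulative.

Section unif_itv.
Context {R : realType}.
Local Open Scope ereal_scope.

Lemma unif_itvNyc (x : R) : unif `]-oo, x]%classic = (clamp x)%:E.
Proof. exact: cdf_lebesgue_stieltjes_id. Qed.

Lemma unif_itv (x : R) : (0 <= x)%R -> unif `[0%R, x]%classic = (clamp x)%:E.
Proof.
move=> x0; rewrite -[in RHS](subr0 (clamp x)) -[in RHS](@clamp_le0 R 0)//.
by apply: (@lebesgue_stieltjes_itvcc _ _ (-1)) => //; rewrite /= ?clamp_le0//; lra.
Qed.

End unif_itv.

(** * Real-valued densities of dominated measures *)

Section density.
Local Open Scope ereal_scope.
Context d {T : measurableType d} {R : realType}.

Section density_of_le_finite.
Variables (mu : {finite_measure set T -> \bar R}) (nu : {measure set T -> \bar R}).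
Hypothesis numu : forall A, measurable A -> nu A <= mu A.

(* The dummy use of [numu] keeps the hypothesis a parameter of the definition,
   so that the finite measure instance can be attached to it. *)
Definition dominated_measure : set T -> \bar R := let _ := numu in nu.

HB.instance Definition _ := Measure.on dominated_measure.

Let dominated_measure_fin : fin_num_fun dominated_measure.
Proof.
move=> A mA; rewrite ge0_fin_numE// (le_lt_trans (numu mA))//.
by rewrite ltey_eq fin_num_measure.
Qed.

HB.instance Definition _ := Measure_isFinite.Build _ _ _ dominated_measure
  dominated_measure_fin.

(** Domination makes [nu] finite and absolutely continuous, so Radon-Nikodym applies; its density is
    finite everywhere, and [fine] makes it real-valued. *)
Lemma density_of_le_finite :
  exists f : T -> R, [/\ forall x, (0 <= f x)%R,
    mu.-integrable setT (EFin \o f) &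
    forall A, measurable A -> nu A = \int[mu]_(x in A) (f x)%:E].
Proof.
have dom : dominated_measure `<< mu.
  by apply/null_content_dominatesP => A mA muA; apply/eqP;
  rewrite -measure_le0 -muA; exact: numu.
have [g [g0 gfin gint gE]] := radon_nikodym_sigma_finite dom.
exists (fine \o g); split => [x||A mA].
- exact: fine_ge0.
- by apply: eq_integrable gint => // x _; rewrite /= fineK.
- by rewrite [LHS]gE//; apply: eq_integral => x _; rewrite /= fineK.
Qed.

End density_of_le_finite.

(** Test the hypothesis on the set where [g < f]: there the integral of [|f - g|] is at most 0, so
    [f = g] almost everywhere on it, and the set is null. *)
Lemma ae_le_of_integral_le (mu : {measure set T -> \bar R}) (f g : T -> R) :
  mu.-integrable setT (EFin \o f) -> mu.-integrable setT (EFin \o g) ->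
  (forall A, measurable A ->
    \int[mu]_(x in A) (f x)%:E <= \int[mu]_(x in A) (g x)%:E) ->
  {ae mu, forall x, (f x <= g x)%R}.
Proof.
move=> intf intg fg.
have mf : measurable_fun setT f by apply/measurable_EFinP; exact: measurable_int intf.
have mg : measurable_fun setT g by apply/measurable_EFinP; exact: measurable_int intg.
pose A := [set x | (g x < f x)%R].
have mA : measurable A.
  by rewrite -[A]setTI; apply: measurable_fun_ltr.
have intfA : mu.-integrable A (EFin \o f) by exact: integrableS intf.
have intgA : mu.-integrable A (EFin \o g) by exact: integrableS intg.
have eq0 : \int[mu]_(x in A) `|(f x - g x)%:E| = 0.
  apply/eqP; rewrite eq_le integral_ge0// andbT.
  rewrite (eq_integral (fun x => (f x)%:E - (g x)%:E)); last first.
    by move=> x /set_mem; rewrite /A /= => xA; rewrite ger0_norm// subr_ge0 ltW.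
  rewrite integralB_EFin// sube_le0; exact: fg.
have mfg : measurable_fun A (fun x => (f x - g x)%:E).
  apply/measurable_EFinP; apply: (@measurable_funS _ _ _ _ setT) => //.
  exact: measurable_funB.
have := (ae_eq_integral_abs mu mA mfg).1 eq0; apply: filterS => x h.
rewrite leNgt; apply/negP => xA; have /= [/eqP] := h xA.
by rewrite subr_eq0 gt_eqF.
Qed.

End density.

(** * Increments of copulas, and their sections as measures *)

Section copula_increments.
Context {R : realType} {C : R -> R -> R}.
Hypothesis hC : is_copula C.

Lemma copula_swap : is_copula (fun u v => C v u).
Proof.
split=> [u v u01 v01|u u01|v v01|u u01|v v01|u1 u2 v1 v2 *].
- exact: copula_range.
- exact: copula_0v.
- exact: copula_u0.
- exact: copula_1v.
- exact: copula_u1.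
- have := @copula_2incr _ _ hC v1 v2 u1 u2; lra.
Qed.

(** The rectangle below height [v] gives the lower bound, the one between [v] and 1 the upper
    bound. *)
Lemma copula_incr_l u1 u2 v : 0 <= u1 -> u1 <= u2 -> u2 <= 1 -> 0 <= v <= 1 ->
  0 <= C u2 v - C u1 v <= u2 - u1.
Proof.
move=> u10 u12 u21 v01; have /andP[v0 v1] := v01.
have h1 := copula_2incr hC u10 u12 u21 (lexx 0) v0 v1.
have h2 := copula_2incr hC u10 u12 u21 v0 v1 (lexx 1).
move: h1 h2; rewrite !(copula_u0 hC) ?(copula_u1 hC); first lra.
all: by apply/andP; split; lra.
Qed.

End copula_increments.

Lemma copula_incr_r {R : realType} {C : R -> R -> R} (hC : is_copula C) u v1 v2 :
  0 <= v1 -> v1 <= v2 -> v2 <= 1 -> 0 <= u <= 1 ->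
  0 <= C u v2 - C u v1 <= v2 - v1.
Proof. exact: (copula_incr_l (copula_swap hC)). Qed.

Section copula_sections.
Context {R : realType} {C : R -> R -> R}.
Hypothesis hC : is_copula C.

(* The dummy use of [hC] makes it a parameter, on which the cumulative instance
   depends. *)
Definition copula_section (q u : R) : R := let _ := hC in C (clamp u) (clamp q).

Lemma copula_section_id q u : 0 <= q <= 1 -> 0 <= u <= 1 ->
  copula_section q u = C u q.
Proof. by move=> q01 u01; rewrite /copula_section !clamp_id. Qed.

Lemma copula_section_le0 q u : u <= 0 -> copula_section q u = 0.
Proof.
by move=> u0; rewrite /copula_section (clamp_le0 u0) (copula_0v hC)// clamp01.
Qed.

Lemma copula_section_incr q u1 u2 : u1 <= u2 ->
  0 <= copula_section q u2 - copula_section q u1 <= clamp u2 - clamp u1.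
Proof.
move=> u12; rewrite /copula_section.
by apply: (copula_incr_l hC); rewrite ?clamp01 ?clamp_ge0 ?clamp_le1 ?clamp_nd.
Qed.

(** This is the 2-increasing property rearranged into a comparison of increments, the form that
    orders the section measures in [q]. *)
Lemma copula_section_nd q1 q2 u1 u2 : q1 <= q2 -> u1 <= u2 ->
  copula_section q1 u2 - copula_section q1 u1 <=
  copula_section q2 u2 - copula_section q2 u1.
Proof.
move=> q12 u12; have := copula_2incr hC (clamp_ge0 u1) (clamp_nd u12) (clamp_le1 u2)
  (clamp_ge0 q1) (clamp_nd q12) (clamp_le1 q2).
rewrite /copula_section; lra.
Qed.

Lemma copula_section_lip q1 q2 u : q1 <= q2 ->
  0 <= copula_section q2 u - copula_section q1 u <= q2 - q1.
Proof.
move=> q12; have /andP[-> /= h] := copula_incr_r hC (clamp_ge0 q1) (clamp_nd q12)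
  (clamp_le1 q2) (clamp01 u).
by rewrite (le_trans h)// clamp_lip.
Qed.

Let copula_section_ndh q : nondecreasing (copula_section q).
Proof. by move=> u1 u2 /(copula_section_incr q) /andP[]; rewrite subr_ge0. Qed.

Let copula_section_rc q : right_continuous (copula_section q).
Proof.
apply: right_continuousW => x; apply: (@lipschitz_cvg _ _ 1) => u1 u2 u12.
have /andP[-> /= h] := copula_section_incr q u12.
by rewrite mul1r (le_trans h)// clamp_lip.
Qed.

HB.instance Definition _ q := isCumulative.Build R _ R (copula_section q)
  (@copula_section_ndh q) (@copula_section_rc q).

Local Open Scope ereal_scope.

(** For a pair [(U, V)] with distribution function [C] this is the measure [P(U in A, V <= q)], here
    defined before any such pair exists. *)
Definition section_measure q : {measure set (measurableTypeR R) -> \bar R} :=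
  lebesgue_stieltjes_measure (copula_section q).

Lemma section_measure_le_unif q A : section_measure q A <= unif A.
Proof.
by apply: le_lebesgue_stieltjes => x y /(copula_section_incr q) /andP[].
Qed.

Lemma section_measure_nd q1 q2 A : (q1 <= q2)%R ->
  section_measure q1 A <= section_measure q2 A.
Proof.
by move=> q12; apply: le_lebesgue_stieltjes => x y; exact: copula_section_nd.
Qed.

Lemma section_measure_itv (q u : R) : (0 <= u)%R ->
  section_measure q `[0%R, u]%classic = (copula_section q u)%:E.
Proof.
move=> u0; rewrite -[in RHS](subr0 (copula_section q u)).
rewrite -[in RHS](@copula_section_le0 q 0%R)//.
by apply: (@lebesgue_stieltjes_itvcc _ _ (-1)) => //;
  rewrite /= ?copula_section_le0//; lra.
Qed.

End copula_sections.

(** * Conditional distribution functions at rational levels *)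

Section conditional_law.
Context {R : realType} {C : R -> R -> R}.
Hypothesis hC : is_copula C.
Local Open Scope ereal_scope.
Notation TR := (measurableTypeR R).

(** Densities satisfy the bounds and the monotonicity in [q] only almost everywhere. Rational levels
    leave countably many exceptional sets, hence a single null set on which the densities can be
    changed. *)
Lemma conditional_cdf : exists f : rat -> TR -> R,
  [/\ forall q s, (0 <= f q s <= 1)%R,
      forall p q s, (p <= q)%R -> (f p s <= f q s)%R,
      forall q, measurable_fun setT (f q) &
      forall (q : rat) (u : R), (0 <= u)%R ->
        \int[unif]_(s in `[0%R, u]%classic) (f q s)%:E =
        (copula_section hC (ratr q) u)%:E].
Proof.
have /choice[g gP] : forall q : rat, exists g : TR -> R,
    [/\ forall s, (0 <= g s)%R, unif.-integrable setT (EFin \o g) &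
    forall A, measurable A -> section_measure hC (ratr q) A =
      \int[unif]_(s in A) (g s)%:E].
  by move=> q; apply: density_of_le_finite => A _; exact: section_measure_le_unif.
have g0 q s : (0 <= g q s)%R by have [] := gP q.
have ig q : unif.-integrable setT (EFin \o g q) by have [] := gP q.
have gE q A : measurable A -> section_measure hC (ratr q) A =
    \int[unif]_(s in A) (g q s)%:E by have [_ _] := gP q; exact.
have mg q : measurable_fun setT (g q).
  by apply/measurable_EFinP; exact: measurable_int (ig q).
pose mono s (p q : rat) := (p <= q)%R ==> (g p s <= g q s)%R.
(* Countably many almost sure properties are merged by enumerating their indices. *)
have [N [mN N0 subN]] : {ae (@unif R), forall s,
    (forall n, if unpickle n is Some (p, q) then mono s p q else true) /\
    (forall n, if unpickle n is Some q then (g q s <= 1)%R else true)}.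
  apply: filterI; apply: ae_foralln => n.
  - case: unpickle => [[p q]|]; last exact: aeW.
    rewrite /mono; have [pq|_] := boolP (p <= q)%R; last exact: aeW.
    apply: ae_le_of_integral_le => // A mA; rewrite -!gE//.
    by apply: section_measure_nd; rewrite ler_rat.
  - case: unpickle => [q|]; last exact: aeW.
    apply: (ae_le_of_integral_le (ig q)) => [|A mA].
      by apply: finite_measure_integrable_cst.
    by rewrite -gE// integral_cst// mul1e; exact: section_measure_le_unif.
have gN s : ~ N s ->
    (forall p q, (p <= q)%R -> (g p s <= g q s)%R) /\ (forall q, (g q s <= 1)%R).
  move=> /(contra_not (@subN s)) /contrapT[h1 h2]; split => [p q|q].
  - by have := h1 (pickle (p, q)); rewrite pickleK => /implyP.
  - by have := h2 (pickle q); rewrite pickleK.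
(* The value 0 on [N], common to all [q], satisfies every pointwise requirement there and leaves the
   integrals unchanged. *)
exists (fun q => g q \* \1_(~` N))%R; split.
- move=> q s /=; rewrite indicE; have [|_] := boolP (s \in ~` N).
    by rewrite inE => /gN[_ h]; rewrite /= mulr1 g0 h.
  by rewrite mulr0 lexx ler01.
- move=> p q s pq /=; rewrite indicE; have [|_] := boolP (s \in ~` N).
    by rewrite inE => /gN[h _]; rewrite /= !mulr1 h.
  by rewrite !mulr0.
- move=> q; apply: measurable_funM => //; apply: measurable_indic.
  exact: measurableC.
- move=> q u u0; rewrite -section_measure_itv// gE; last exact: measurable_itv.
  have mI : measurable (`[0%R, u]%classic : set TR) by exact: measurable_itv.
  apply: ae_eq_integral => //.
  + apply/measurable_EFinP; apply: (@measurable_funS _ _ _ _ setT) => //.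
    apply: measurable_funM => //; apply: measurable_indic.
    exact: measurableC.
  + by apply/measurable_EFinP; apply: (@measurable_funS _ _ _ _ setT).
  + exists N; split => // s /= h; apply: contrapT => Ns; apply: h => _.
    by rewrite indicE mem_set//= mulr1.
Qed.

End conditional_law.

(** * Existence of the measure of a copula *)

Section joint_law.
Context {R : realType} {C : R -> R -> R}.
Hypothesis hC : is_copula C.
Local Open Scope ereal_scope.
Notation TR := (measurableTypeR R).
Notation unif2 := (@unif R \x @unif R).

Lemma measurable_subgraph (D : set TR) (h : TR -> R) :
  measurable D -> measurable_fun setT h ->
  measurable [set p : plane R | D p.1 /\ (p.2 <= h p.1)%R].
Proof.
move=> mD mh.
have -> : [set p : plane R | D p.1 /\ (p.2 <= h p.1)%R] =
  (D `*` setT) `&` [set p | (p.2 <= h p.1)%R].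
  by apply/seteqP; split => p /= [] // []//.
apply: measurableI; first exact: measurableX.
rewrite -[X in measurable X]setTI.
apply: (@measurable_fun_ler _ _ _ setT (fun p : plane R => p.2 : R)
  (fun p : plane R => h p.1)) => //.
- exact: measurable_snd.
- by apply: measurableT_comp => //; exact: measurable_fst.
Qed.

(** For [s] in [D] the vertical section is the half-line up to [h s], of uniform mass [h s] because
    this value lies in [0,1]. *)
Lemma unif2_subgraph (D : set TR) (h : TR -> R) :
  measurable D -> measurable_fun setT h -> (forall s, (0 <= h s <= 1)%R) ->
  unif2 [set p : plane R | D p.1 /\ (p.2 <= h p.1)%R] =
  \int[unif]_(s in D) (h s)%:E.
Proof.
move=> mD mh h01; rewrite /product_measure1 [RHS]integral_mkcond.
apply: eq_integral => s _ /=; rewrite patchE; case: ifPn => sD.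
- rewrite -(clamp_id (h01 s)) -unif_itvNyc; congr (unif _).
  rewrite /xsection; apply/seteqP; split => t /=; rewrite inE /= in_itv /=.
    by case.
  by move=> ts; split => //; exact: set_mem.
- rewrite [X in unif X](_ : _ = set0) ?measure0//; apply/seteqP; split => t //.
  by rewrite /xsection /= inE /= => -[/mem_set]; rewrite (negbTE sD).
Qed.

Lemma copula_df_exists : exists P : probability (plane R) R, has_copula_df C P.
Proof.
have [f [f01 fnd mf fE]] := conditional_cdf hC.
(* [1 <= q] is made a disjunct so that the infimum [G] below is never taken over
   an empty set. *)
pose A (q : rat) := [set p : plane R |
  (0 <= q)%R /\ ((1 <= q)%R \/ (p.2 <= f q p.1)%R)].
pose S p := [set x : R | exists2 q : rat, x = ratr q & A q p].
pose G (p : plane R) : TR := inf (S p).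
have mA q : measurable (A q).
  have [q0|q0] := boolP (0 <= q)%R; last first.
    rewrite (_ : A q = set0)//; apply/seteqP; split => p // -[].
    by rewrite (negbTE q0).
  have [q1|q1] := boolP (1 <= q)%R.
    by rewrite (_ : A q = setT)//; apply/seteqP; split => p // _; split => //; left.
  rewrite (_ : A q = [set p | setT p.1 /\ (p.2 <= f q p.1)%R]).
    exact: measurable_subgraph.
  apply/seteqP; split => p /= []// _ => [[|//]|]; first by rewrite (negbTE q1).
  by split => //; right.
have And p q1 q2 : (q1 <= q2)%R -> A q1 p -> A q2 p.
  move=> q12 [q10 h]; split; first exact: le_trans q12.
  case: h => h; [left; exact: le_trans q12|right].
  by rewrite (le_trans h)// fnd.
have S1 p : S p 1%R by exists 1%R; [rewrite rmorph1|split => //; left].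
have S0 p : lbound (S p) 0%R by move=> _ [q -> [q0 _]]; rewrite ler0q.
have G0 p : (0 <= G p)%R by apply: lb_le_inf => //; exists 1%R.
have GleA p q : A q p -> (G p <= ratr q)%R.
  by move=> Aqp; apply: ge_inf; [exists 0%R|exists q].
have GltA p (w : R) : (G p < w)%R -> exists2 q : rat, (ratr q < w)%R & A q p.
  move=> Gw; have [|_ [q -> Aqp] qw] := @inf_lt _ (S p) w _ Gw; first by exists 1%R.
  by exists q.
have mG : measurable_fun setT G.
  move=> mT; apply: (measurability _ (RGenInftyO.measurableE R)) => //.
  move=> _ [_ [x ->] <-]; rewrite setTI.
  (* The infimum lies below [x] exactly when some rational below [x] is admissible, which makes the
     preimage a countable union. *)
  have -> : G @^-1` `]-oo, x[%classic =
      \bigcup_(q in [set: rat]) (if (ratr q < x)%R then A q else set0).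
    apply/seteqP; split => p /=; rewrite in_itv /=.
      by move=> /GltA[q qx Aqp]; exists q => //; rewrite qx.
    move=> [q _]; case: ifPn => // qx Aqp.
    exact: le_lt_trans (GleA _ _ Aqp) qx.
  by apply: bigcupT_measurable_rat => q; case: ifP.
pose H (p : plane R) : plane R := (p.1, G p).
have mH : measurable_fun setT H.
  by apply: measurable_fun_pair => //; exact: measurable_fst.
pose Hm : {mfun plane R >-> plane R} := mfun_Sub (mem_set mH).
exists (distribution unif2 Hm) => u v u01 v01.
have /andP[u0 u1] := u01; have /andP[v0 v1] := v01.
pose I : set TR := `[0%R, u]%classic.
pose J : set TR := `[0%R, v]%classic.
have mI : measurable I by exact: measurable_itv.
have mJ : measurable J by exact: measurable_itv.
pose E := H @^-1` (I `*` J).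
have mE : measurable E.
  by rewrite -[E]setTI; exact: (mH measurableT _ (measurableX mI mJ)).
have EP p : E p <-> I p.1 /\ (G p <= v)%R.
  by rewrite /E /I /J /= !in_itv /= G0.
change (unif2 E = (C u v)%:E).
pose B q := [set p : plane R | I p.1 /\ (p.2 <= f q p.1)%R].
have mB q : measurable (B q) by exact: measurable_subgraph.
have muB q : unif2 (B q) = (copula_section hC (ratr q) u)%:E.
  by rewrite unif2_subgraph// fE.
have CE : C u v = copula_section hC v u by rewrite copula_section_id.
have Efin : unif2 E \is a fin_num.
  exact: (@fin_num_measure _ _ _ (distribution unif2 Hm) _ (measurableX mI mJ)).
rewrite -(fineK Efin); congr EFin; apply/eqP; rewrite eq_le; apply/andP; split.
(* At [v = 1] no rational [q] with [v < q < 1] exists; there the first marginal alone bounds the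
   mass by [u]. *)
- have [v1'|v1'] := ltP v 1%R; last first.
    have -> : v = 1%R by apply/eqP; rewrite eq_le v1.
    rewrite (copula_u1 hC)// -lee_fin fineK//.
    have -> : u%:E = unif2 (I `*` setT).
      rewrite product_measure1E// [X in X * _](unif_itv u0) clamp_id//.
      by rewrite [X in _ * X](@probability_setT _ _ _ unif) mule1.
    apply: le_measure; rewrite ?inE//; first exact: measurableX.
    by move=> p /EP[].
  rewrite leNgt; apply/negP => abs.
  (* The level [q] exceeds [v] by less than the supposed excess of mass, against the Lipschitz
     bound; [q < 1] rules out the artificial disjunct of [A q]. *)
  have [|q] := @rat_in_itvoo R v (Num.min 1 (v + (fine (unif2 E) - C u v)))%R.
    by rewrite lt_min v1' /= ltrDl subr_gt0.
  rewrite in_itv /= lt_min => /and3P[vq q1 qv].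
  have : (fine (unif2 E) <= copula_section hC (ratr q) u)%R.
    rewrite -lee_fin fineK// -muB; apply: le_measure; rewrite ?inE//.
    move=> p /EP[Ip Gpv]; split => //.
    have [q' q'q Aq'] := GltA p (ratr q) (le_lt_trans Gpv vq).
    have [_ []//] : A q p by apply: And Aq'; rewrite -(ler_rat R) ltW.
    by rewrite leNgt -(ltr_rat R) rmorph1 q1.
  have /andP[_] := copula_section_lip hC u (ltW vq); rewrite -CE; lra.
- rewrite leNgt; apply/negP => abs.
  have v0' : (0 < v)%R.
    rewrite lt_neqAle v0 andbT; apply/eqP => v0'; move: abs.
    by rewrite -v0' (copula_u0 hC)// ltNge fine_ge0.
  (* Symmetrically, [q] falls short of [v] by less than the supposed deficit, and [0 < q] makes it
     admissible in [A q]. *)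
  have [|q] := @rat_in_itvoo R (Num.max 0 (v - (C u v - fine (unif2 E))))%R v.
    by rewrite gt_max v0' /= ltrBlDr ltrDl subr_gt0.
  rewrite in_itv /= gt_max => /andP[/andP[q0 vq] qv].
  have : (copula_section hC (ratr q) u <= fine (unif2 E))%R.
    rewrite -lee_fin fineK// -muB; apply: le_measure; rewrite ?inE//.
    move=> p [Ip pf]; apply/EP; split => //; rewrite (le_trans _ (ltW qv))// GleA//.
    by split; [rewrite -(ler0q R) ltW|right].
  have /andP[_] := copula_section_lip hC u (ltW qv); rewrite -CE; lra.
Qed.

(** Existence guarantees that [get] returns a measure with distribution function [C] rather than its
    default. *)
Lemma copula_measureP : has_copula_df C (copula_measure C).
Proof.
have [P CP] := copula_df_exists.
exact: (@getPex _ [set P | has_copula_df C P] (ex_intro _ P CP)).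
Qed.

End joint_law.

(** * The expected minimum in terms of the diagonal *)

Section diagonal_section.
Context {R : realType}.
Local Open Scope ereal_scope.
Notation TR := (measurableTypeR R).
Notation leb := (@lebesgue_measure R).

Let gt_both (t : R) : set (plane R) :=
  [set p | unit_square R p /\ (t < p.1)%R /\ (t < p.2)%R].

Let measurable_unit_square : measurable (unit_square R).
Proof. by apply: measurableX; exact: measurable_itv. Qed.

(** Layer-cake formula: Tonelli for the region [Z] of pairs [(p, t)] with [0 <= t < min(p.1, p.2)],
    sliced in both directions. *)
Lemma integral_min_tail (P : probability (plane R) R) :
  \int[P]_(p in unit_square R) (Num.min p.1 p.2 : R)%:E =
  \int[leb]_(t in `[0%R, 1%R]%classic) P (gt_both t).
Proof.
pose Z : set (plane R * TR) :=
  [set z | [/\ unit_square R z.1, (0 <= z.2)%R, (z.2 < z.1.1)%R & (z.2 < z.1.2)%R]].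
have mZ : measurable Z.
  have -> : Z = (unit_square R `*` `[0%R, +oo[%classic) `&`
      ([set z | (z.2 < z.1.1)%R] `&` [set z | (z.2 < z.1.2)%R]).
    apply/seteqP; split => z /=; rewrite in_itv /= andbT.
      by case=> h1 h2 h3 h4; split.
    by case=> -[h1 h2] [h3 h4]; split.
  apply: measurableI; first by apply: measurableX => //; exact: measurable_itv.
  have m11 : measurable_fun setT (fun z : plane R * TR => z.1.1 : R).
    by apply: measurableT_comp; [exact: measurable_fst|exact: measurable_fst].
  have m12 : measurable_fun setT (fun z : plane R * TR => z.1.2 : R).
    by apply: measurableT_comp; [exact: measurable_snd|exact: measurable_fst].
  have m2 : measurable_fun setT (fun z : plane R * TR => z.2 : R).
    exact: measurable_snd.
  apply: measurableI; rewrite -[X in measurable X]setTI.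
  - exact: (measurable_fun_ltr m2 m11).
  - exact: (measurable_fun_ltr m2 m12).
have := @indic_fubini_tonelli _ _ (plane R) TR R P leb Z mZ.
rewrite indic_fubini_tonelli_FE// indic_fubini_tonelli_GE// => h.
transitivity (\int[P]_x (leb \o xsection Z) x).
  rewrite [LHS]integral_mkcond; apply: eq_integral => p _ /=.
  rewrite patchE; case: ifPn => pS.
    have := set_mem pS; rewrite /unit_square /= !in_itv /=.
    move=> -[/andP[p10 p11] /andP[p20 p21]].
    have -> : xsection Z p = `[0%R, Num.min p.1 p.2[%classic.
      rewrite /xsection; apply/seteqP; split => t /=; rewrite inE /Z /= in_itv /= lt_min.
        by case=> _ -> -> ->.
      by move=> /and3P[? ? ?]; split => //; exact: set_mem.
    (* An empty interval gets length 0, which agrees with the minimum: on the square it is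
       nonnegative, so here it is 0. *)
    rewrite lebesgue_measure_itv /= lte_fin; case: ltP => [_|m0].
      by rewrite oppr0 adde0.
    by apply/eqP; rewrite eqe eq_le m0 le_min p10.
  rewrite [X in leb X](_ : _ = set0) ?measure0//.
  rewrite /xsection; apply/seteqP; split => t //=; rewrite inE /Z /= => -[/mem_set].
  by rewrite (negbTE pS).
rewrite h [RHS]integral_mkcond; apply: eq_integral => t _ /=.
rewrite patchE; case: ifPn => tI.
  have := set_mem tI; rewrite /= in_itv /= => /andP[t0 t1].
  congr (P _); rewrite /ysection; apply/seteqP; split => p /=; rewrite inE /Z /=.
    by case.
  by case=> ? [].
rewrite [X in P X](_ : _ = set0) ?measure0//.
rewrite /ysection; apply/seteqP; split => p //=; rewrite inE /Z /= => -[].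
rewrite /unit_square /= !in_itv /= => -[/andP[_ p1] _] t0 tp _.
by move: tI; rewrite notin_setE /=; apply; rewrite in_itv /= t0 ltW// (lt_le_trans tp).
Qed.

(** Inclusion-exclusion: from the square remove two strips of mass [t] each, whose overlap has mass
    [C t t]. *)
Lemma copula_df_gt_both (C : R -> R -> R) (hC : is_copula C)
    (P : probability (plane R) R) (t : R) : has_copula_df C P ->
  (0 <= t <= 1)%R -> P (gt_both t) = (1 - 2 * t + C t t)%:E.
Proof.
move=> CP /andP[t0 t1].
have t01 : (0 <= t <= 1)%R by rewrite t0.
have l01 : (0 <= (1 : R) <= 1)%R by rewrite ler01 lexx.
pose A : set (plane R) := `[0%R, t]%classic `*` `[0%R, 1%R]%classic.
pose B : set (plane R) := `[0%R, 1%R]%classic `*` `[0%R, t]%classic.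
have mA : measurable A by apply: measurableX; exact: measurable_itv.
have mB : measurable B by apply: measurableX; exact: measurable_itv.
have PA : P A = t%:E by rewrite /A CP// (copula_u1 hC).
have PB : P B = t%:E by rewrite /B CP// (copula_1v hC).
have PAB : P (A `&` B) = (C t t)%:E.
  rewrite -CP//; congr (P _); apply/seteqP; split => p; rewrite /A /B /= !in_itv /=.
    by move=> [[/andP[-> ->] _] [_ /andP[-> ->]]].
  by move=> [/andP[p0 pt] /andP[p0' pt']]; rewrite p0 pt p0' pt' !(le_trans _ t1).
have PS : P (unit_square R) = 1%:E by rewrite CP// (copula_u1 hC).
have -> : gt_both t = unit_square R `\` (A `|` B).
  apply/seteqP; split => p; rewrite /gt_both /A /B /unit_square /= !in_itv /=.
    move=> [[/andP[-> ->] /andP[-> ->]] [tp1 tp2]]; split => //.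
    by rewrite !leNgt tp1 tp2 /= => -[[]|[]].
  move=> [[/andP[p0 p1] /andP[p0' p1']] h]; do ! split; rewrite ?p0 ?p0'// ltNge;
    apply/negP => pt; apply: h; [left|right]; split; exact/andP.
have sub : A `|` B `<=` unit_square R.
  move=> p; rewrite /A /B /unit_square /= !in_itv /=.
  by move=> -[] [/andP[-> h] /andP[-> h']]; rewrite ?h ?h' /=;
    split => //; exact: le_trans t1.
have PU : P (A `|` B) = (t + t - C t t)%:E.
  rewrite measureUfinr//; last by rewrite [X in X < _]PB ltry.
  by rewrite [X in X + _ - _]PA [X in _ + X - _]PB [X in _ - X]PAB.
rewrite measureD//; [|exact: measurableU|by rewrite [X in X < _]PS ltry].
rewrite setIC (setIidl sub) [X in X - _]PS [X in _ - X]PU -EFinB; congr EFin; lra.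
Qed.

Lemma Rintegral_copula_min (C : R -> R -> R) (hC : is_copula C)
    (P : probability (plane R) R) :
  has_copula_df C P ->
  (\int[P]_(p in unit_square R) Num.min p.1 p.2 =
   \int[leb]_(t in `[0, 1]) (1 - 2 * t + C t t))%R.
Proof.
move=> CP; rewrite /Rintegral integral_min_tail; congr fine.
by apply: eq_integral => t /set_mem; rewrite /= in_itv /= => /(copula_df_gt_both hC CP).
Qed.

End diagonal_section.

(** * Integrals over segments and affine comparison *)

Section integral_segment.
Context {R : realType}.
Notation leb := (@lebesgue_measure R).
Implicit Types (a b k c : R) (f : R -> R).

Lemma continuous_integrable_segment a b f : continuous f ->
  leb.-integrable `[a, b] (EFin \o f).
Proof.
move=> cf; apply: continuous_compact_integrable; first exact: segment_compact.
exact: continuous_subspaceT.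
Qed.

Lemma Rintegral_segment_split a b c f : a <= b -> b <= c -> continuous f ->
  \int[leb]_(x in `[a, c]) f x =
  \int[leb]_(x in `[a, b]) f x + \int[leb]_(x in `[b, c]) f x.
Proof.
move=> ab bc cf; apply/eqP; rewrite addrC -subr_eq; apply/eqP.
rewrite Rintegral_itvB ?bnd_simp//; last exact: continuous_integrable_segment.
apply: Rintegral_itv_obnd_cbnd.
apply: integrableS (continuous_integrable_segment b c cf) => //.
exact: subset_itv_oc_cc.
Qed.

Let continuous_affine k c : continuous (fun x : R => k * x + c).
Proof.
move=> x; apply: cvgD; last exact: cvg_cst.
by apply: cvgM; [exact: cvg_cst|exact: cvg_id].
Qed.

Lemma Rintegral_affine a b k c : a <= b ->
  \int[leb]_(x in `[a, b]) (k * x + c) =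
  k / 2 * (b ^+ 2 - a ^+ 2) + c * (b - a).
Proof.
(* The fundamental theorem of calculus is applied only for [a < b], so the one-point segment is
   treated apart. *)
rewrite le_eqVlt => /predU1P[->|ab].
  by rewrite set_itv1 Rintegral_set1 !subrr !mulr0 addr0.
pose F x : R := k / 2 * x ^+ 2 + c * x.
have dF (x : R) : is_derive x 1 F (k * x + c).
  rewrite /F; apply: is_derive_eq.
  by rewrite /GRing.scale /= !mulr1; lra.
rewrite /Rintegral (@continuous_FTC2 _ _ F)//.
- rewrite /F /=; ring.
- exact: continuous_subspaceT.
- have cF (x : R) : F @ x --> F x.
    by apply: differentiable_continuous; apply/derivable1_diffP; have [] := dF x.
  split.
  + by move=> x _; have [] := dF x.
  + exact: cvg_at_right_filter.
  + exact: cvg_at_left_filter.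
- by move=> x _; rewrite derive1E; have [_ ->] := dF x.
Qed.

Lemma Rintegral_ge_affine a b k c f : a <= b -> continuous f ->
  (forall x, a <= x <= b -> k * x + c <= f x) ->
  k / 2 * (b ^+ 2 - a ^+ 2) + c * (b - a) <= \int[leb]_(x in `[a, b]) f x.
Proof.
move=> ab cf kf; rewrite -Rintegral_affine//; apply: le_Rintegral => //;
  exact: continuous_integrable_segment.
Qed.

Lemma Rintegral_le_affine a b k c f : a <= b -> continuous f ->
  (forall x, a <= x <= b -> f x <= k * x + c) ->
  \int[leb]_(x in `[a, b]) f x <= k / 2 * (b ^+ 2 - a ^+ 2) + c * (b - a).
Proof.
move=> ab cf kf; rewrite -Rintegral_affine//; apply: le_Rintegral => //;
  exact: continuous_integrable_segment.
Qed.

End integral_segment.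

(** * Bounds on the integral of the diagonal *)

Section diagonal_bounds.
Context {R : realType} {C : R -> R -> R}.
Hypothesis hC : is_copula C.
Notation leb := (@lebesgue_measure R).

(** The truncated diagonal is continuous on the whole line, as the segment lemmas require. *)
Let delta (t : R) : R := C (clamp t) (clamp t).

Let delta_id t : 0 <= t <= 1 -> C t t = delta t.
Proof. by move=> t01; rewrite /delta clamp_id. Qed.

Let delta_incr (t1 t2 : R) : t1 <= t2 -> 0 <= delta t2 - delta t1 <= 2 * (t2 - t1).
Proof.
move=> t12; rewrite /delta.
have := copula_incr_l hC (clamp_ge0 t1) (clamp_nd t12) (clamp_le1 t2) (clamp01 t1).
have := copula_incr_r hC (clamp_ge0 t1) (clamp_nd t12) (clamp_le1 t2) (clamp01 t2).
have := clamp_lip t12.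
lra.
Qed.

Lemma diagonal_ge0 t : 0 <= t <= 1 -> 0 <= C t t.
Proof. by move=> t01; have /andP[] := copula_range hC t01 t01. Qed.

Lemma diagonal_le t : 0 <= t <= 1 -> C t t <= t.
Proof.
move=> t01; have /andP[t0 t1] := t01.
have := copula_incr_r hC t0 t1 (lexx 1) t01; rewrite (copula_u1 hC)//; lra.
Qed.

Let g (t : R) : R := (-2) * t + 1 + delta t.

Let cg : continuous g.
Proof.
move=> t; apply: cvgD; last exact: (lipschitz_cvg (k := 2)).
by apply: cvgD; [apply: cvgM; [exact: cvg_cst|exact: cvg_id]|exact: cvg_cst].
Qed.

Let I := \int[leb]_(t in `[0, 1]) (1 - 2 * t + C t t).
Let d := C 2^-1 2^-1.

Let IE : I = \int[leb]_(t in `[0, 1]) g t.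
Proof.
rewrite /I; apply: eq_Rintegral => t; rewrite inE /= in_itv /= => /delta_id ->.
rewrite /g; lra.
Qed.

Let half01 : 0 <= (2^-1 : R) <= 1.
Proof. by apply/andP; split; lra. Qed.

Let deltah : delta 2^-1 = d.
Proof. by rewrite -delta_id. Qed.

Let delta_le t : 0 <= t <= 1 -> delta t <= t.
Proof. by move=> t01; rewrite -delta_id// diagonal_le. Qed.

(** The diagonal lies below [min(t, d)] before 1/2 and below [min(t, d + 2t - 1)] after it. The
    branches cross at [d] and at [1 - d], which gives the four segments. *)
Lemma diagonal_integral_le : I <= 2^-1 - (2^-1 - d) ^+ 2.
Proof.
have d0 : 0 <= d by exact: diagonal_ge0.
have d1 : d <= 2^-1 by exact: diagonal_le.
rewrite IE (@Rintegral_segment_split _ 0 d)//; [|lra].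
rewrite (@Rintegral_segment_split _ d 2^-1)//; [|lra].
rewrite (@Rintegral_segment_split _ 2^-1 (1 - d))//; [|lra|lra].
have h1 : \int[leb]_(t in `[0, d]) g t <= (-1) / 2 * (d ^+ 2 - 0 ^+ 2) + 1 * (d - 0).
  apply: Rintegral_le_affine => // t /andP[t0 t1].
  have : delta t <= t by apply: delta_le; apply/andP; split; lra.
  rewrite /g; lra.
have h2 : \int[leb]_(t in `[d, 2^-1]) g t <=
    (-2) / 2 * ((2^-1) ^+ 2 - d ^+ 2) + (1 + d) * (2^-1 - d).
  apply: Rintegral_le_affine => // t /andP[t0 t1].
  have := delta_incr t1; rewrite deltah /g; lra.
have h3 : \int[leb]_(t in `[2^-1, 1 - d]) g t <=
    0 / 2 * ((1 - d) ^+ 2 - (2^-1) ^+ 2) + d * (1 - d - 2^-1).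
  apply: Rintegral_le_affine => //; first lra.
  by move=> t /andP[t0 t1]; have := delta_incr t0; rewrite deltah /g; lra.
have h4 : \int[leb]_(t in `[1 - d, 1]) g t <=
    (-1) / 2 * (1 ^+ 2 - (1 - d) ^+ 2) + 1 * (1 - (1 - d)).
  apply: Rintegral_le_affine => //; first lra.
  move=> t /andP[t0 t1].
  have : delta t <= t by apply: delta_le; apply/andP; split; lra.
  rewrite /g; lra.
move: h1 h2 h3 h4; rewrite !expr2; lra.
Qed.

(** The diagonal lies above [max(0, d + 2t - 1)] before 1/2 and above [max(d, 2t - 1)] after it, the
    last branch coming from [C 1 1 = 1]. The branches cross at [(1 - d) / 2] and [(1 + d) / 2]. *)
Lemma diagonal_integral_ge : 4^-1 + d ^+ 2 / 2 <= I.
Proof.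
have d0 : 0 <= d by exact: diagonal_ge0.
have d1 : d <= 2^-1 by exact: diagonal_le.
have delta0 t : 0 <= delta t.
  by rewrite /delta; apply: diagonal_ge0; exact: clamp01.
rewrite IE (@Rintegral_segment_split _ 0 (2^-1 - d / 2))//; [|lra|lra].
rewrite (@Rintegral_segment_split _ (2^-1 - d / 2) 2^-1)//; [|lra|lra].
rewrite (@Rintegral_segment_split _ 2^-1 (2^-1 + d / 2))//; [|lra|lra].
have h1 : (-2) / 2 * ((2^-1 - d / 2) ^+ 2 - 0 ^+ 2) + 1 * (2^-1 - d / 2 - 0) <=
    \int[leb]_(t in `[0, 2^-1 - d / 2]) g t.
  apply: Rintegral_ge_affine => //; first lra.
  by move=> t _; rewrite /g; have := delta0 t; lra.
have h2 : 0 / 2 * ((2^-1) ^+ 2 - (2^-1 - d / 2) ^+ 2) + d * (2^-1 - (2^-1 - d / 2)) <=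
    \int[leb]_(t in `[2^-1 - d / 2, 2^-1]) g t.
  apply: Rintegral_ge_affine => //; first lra.
  by move=> t /andP[t0 t1]; have := delta_incr t1; rewrite deltah /g; lra.
have h3 : (-2) / 2 * ((2^-1 + d / 2) ^+ 2 - (2^-1) ^+ 2) +
    (1 + d) * (2^-1 + d / 2 - 2^-1) <=
    \int[leb]_(t in `[2^-1, 2^-1 + d / 2]) g t.
  apply: Rintegral_ge_affine => //; first lra.
  by move=> t /andP[t0 t1]; have := delta_incr t0; rewrite deltah /g; lra.
have h4 : 0 / 2 * (1 ^+ 2 - (2^-1 + d / 2) ^+ 2) + 0 * (1 - (2^-1 + d / 2)) <=
    \int[leb]_(t in `[2^-1 + d / 2, 1]) g t.
  apply: Rintegral_ge_affine => //; first lra.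
  move=> t /andP[t0 t1]; have := delta_incr t1.
  have -> : delta 1 = 1 by rewrite /delta !clamp_ge1// (copula_u1 hC)// ler01 lexx.
  rewrite /g; lra.
move: h1 h2 h3 h4; rewrite !expr2; lra.
Qed.

End diagonal_bounds.

(** * From the footrule to the bounds on Blomqvist's beta *)

Lemma spearman_footruleE (R : realType) (C : R -> R -> R) (hC : is_copula C) :
  spearman_footrule C =
  6 * (\int[@lebesgue_measure R]_(t in `[0, 1]) (1 - 2 * t + C t t)) - 2.
Proof.
rewrite /spearman_footrule /concordance /copulaM.
by rewrite (Rintegral_copula_min hC (copula_measureP hC)); lra.
Qed.

Theorem corollary8 (R : realType) (C : R -> R -> R) (hC : is_copula C) :
  let phi := spearman_footrule C in
  (- 2^-1 <= phi <= 1) /\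
  (1 - 4 * Num.sqrt ((1 - phi) / 6) <= blomqvist_beta C) /\
  (blomqvist_beta C <=
     if 4^-1 <= phi <= 1 then 1
     else -1 + 4 * Num.sqrt ((1 + 2 * phi) / 6)).
Proof.
move=> phi; rewrite /blomqvist_beta.
have half01 : 0 <= (2^-1 : R) <= 1 by apply/andP; split; lra.
have d0 := diagonal_ge0 hC half01.
have d1 := diagonal_le hC half01.
pose I := \int[@lebesgue_measure R]_(t in `[0, 1]%classic) (1 - 2 * t + C t t).
have hle : I <= 2^-1 - (2^-1 - C 2^-1 2^-1) ^+ 2 := diagonal_integral_le hC.
have hge : 4^-1 + C 2^-1 2^-1 ^+ 2 / 2 <= I := diagonal_integral_ge hC.
have phiE : phi = 6 * I - 2 := spearman_footruleE hC.
move: (C _ _) hle hge d0 d1 => d hle hge d0 d1.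
(* Here [(1 - phi) / 6 = 1/2 - I], which [hle] bounds below by [(1/2 - d)^2]. *)
have s1 : 2^-1 - d <= Num.sqrt ((1 - phi) / 6).
  rewrite -[leLHS]ger0_norm ?subr_ge0// -sqrtr_sqr ler_wsqrtr//; lra.
(* Here [(1 + 2 * phi) / 6 = 2 * I - 1/2], which [hge] bounds below by [d^2]. *)
have s2 : d <= Num.sqrt ((1 + 2 * phi) / 6).
  rewrite -[leLHS]ger0_norm// -sqrtr_sqr ler_wsqrtr//; lra.
split; last split.
- have := sqr_ge0 (2^-1 - d); have := sqr_ge0 d; lra.
- lra.
(* The constant bound 1 is [d <= 1/2]; the other branch is [s2]. Each holds for every value of
   [phi]. *)
- case: ifP => _; lra.
Qed.
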